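(* Let $T$ and $B$ be lattice paths with steps $N=(0,1)$ and $E=(1,0)$ from the origin to $(x,y)\in\mathbb N^2$, with $T$ weakly above $B$, and let $k\ge1$. For any sequence $\mathbf u$ of nonnegative integers, the distribution of $(h_0,h_1,\dots,h_k)$ over $\mathcal P^k(T,B,\mathbf u)$ is symmetric: for every permutation $\pi$ of $\{0,\dots,k\}$, $$\sum_{\mathbf P\in\mathcal P^k(T,B,\mathbf u)}\prod_{i=0}^k z_i^{h_i(\mathbf P)}=\sum_{\mathbf P\in\mathcal P^k(T,B,\mathbf u)}\prod_{i=0}^k z_i^{h_{\pi(i)}(\mathbf P)}.$$
   Context: $T$ weakly above $B$ means no point of $T$ is strictly below or strictly to the right of $B$. $\mathcal P(T,B)$ is the set of lattice paths with steps $N,E$ from the origin to $(x,y)$ weakly above $B$ and weakly below $T$. $\mathcal P^k(T,B)$ is the set of $k$-tuples $\mathbf P=(P_1,\dots,P_k)$ of paths in $\mathcal P(T,B)$ with $P_i$ weakly above $P_{i+1}$. With $P_0=T$, $P_{k+1}=B$, $h_i(\mathbf P)$ ($0\le i\le k$) is the number of east steps on which $P_i$ and $P_{i+1}$ coincide. For $1\le s\le y-1$, $u_s(\mathbf P)$ is the number of unit east steps of the lattice with $y$-coordinate $y-s$ that lie strictly between $T$ and $B$ and are not used by any of $P_1,\dots,P_k$; $\mathbf u(\mathbf P)=(u_1,u_2,\dots)$, and $\mathcal P^k(T,B,\mathbf u)=\{\mathbf P\in\mathcal P^k(T,B):\mathbf u(\mathbf P)=\mathbf u\}$. *)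

(* Defs.v *)
From HB Require Import structures.
From mathcomp Require Import all_boot all_order all_algebra all_fingroup.
From mathcomp Require Export mpoly.

Set Implicit Arguments.
Unset Strict Implicit.
Unset Printing Implicit Defensive.

(* The two unit steps (0,1) and (1,0). *)
Definition north : bool := true.
Definition east : bool := false.

Record lpath (x y : nat) := LPath {
  steps :> (x + y).-tuple bool;
  _ : count_mem east steps == x
}.

HB.instance Definition _ x y := [isSub for @steps x y].
HB.instance Definition _ x y := [Finite of lpath x y by <:].

Definition point (p : seq bool) (n : nat) : nat * nat :=
  (count_mem east (take n p), count_mem north (take n p)).

Definition points (p : seq bool) : seq (nat * nat) :=
  [seq point p n | n <- iota 0 (size p).+1].

(* A unit east step of the lattice is encoded by its left endpoint. *)
Definition east_steps (p : seq bool) : seq (nat * nat) :=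
  [seq point p n | n <- iota 0 (size p) & nth north p n == east].

(* A path meets a vertical (resp. horizontal) line in a segment, so a point is
   strictly below (resp. right of) the path when it is so with respect to every
   point of the path on that line. *)
Definition strictly_below (a : nat * nat) (q : seq bool) : bool :=
  all (fun b => (b.1 == a.1) ==> (a.2 < b.2)) (points q).

Definition strictly_right (a : nat * nat) (q : seq bool) : bool :=
  all (fun b => (b.2 == a.2) ==> (b.1 < a.1)) (points q).

Definition weakly_above (p q : seq bool) : bool :=
  ~~ has (fun a => strictly_below a q || strictly_right a q) (points p).

Section Statistics.

Variables (x y : nat) (T B : lpath x y).

Definition pathsTB : {set lpath x y} :=
  [set P : lpath x y | weakly_above P B & weakly_above T P].

Definition tuplesTB (k : nat) : {set k.-tuple (lpath x y)} :=
  [set P : k.-tuple (lpath x y) |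
    all (mem pathsTB) P & sorted (fun p q : lpath x y => weakly_above p q) P].

(* The path P_i for 0 <= i <= k + 1, with P_0 = T and P_(k+1) = B. *)
Definition pathi k (P : k.-tuple (lpath x y)) (i : nat) : lpath x y :=
  nth B (T :: rcons P B) i.

Definition hstat k (P : k.-tuple (lpath x y)) (i : nat) : nat :=
  count (mem (east_steps (pathi P i.+1))) (east_steps (pathi P i)).

(* The open unit step lies strictly below T and strictly above B; its
   endpoints are allowed to lie on T or B. *)
Definition strictly_between (e : nat * nat) : bool :=
  has (fun t => (t.1 == e.1) && (e.2 < t.2)) (east_steps T) &&
  has (fun b => (b.1 == e.1) && (b.2 < e.2)) (east_steps B).

Definition ustat k (P : k.-tuple (lpath x y)) (s : nat) : nat :=
  #|[set a : 'I_x | strictly_between (nat_of_ord a, y - s) &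
      ~~ has (fun p : lpath x y => (nat_of_ord a, y - s) \in east_steps p) P]|.

(* (u_1, ..., u_(y-1)) *)
Definition uvec k (P : k.-tuple (lpath x y)) : seq nat :=
  [seq ustat P s | s <- iota 1 y.-1].

Definition tuplesTBu (k : nat) (u : seq nat) : {set k.-tuple (lpath x y)} :=
  [set P in tuplesTB k | uvec P == u].

End Statistics.

(* Main.v *)
Require Import Defs.
From mathcomp Require Import all_boot all_order all_algebra all_fingroup.
From mathcomp Require Import mpoly.
From mathcomp Require Import zify ring.

(* A path is a weakly increasing sequence of heights of its east steps, and
   being weakly above is the pointwise order.  Replacing [P_i] inside the region
   between [P_(i-1)] and [P_(i+1)] only affects [h_(i-1)] and [h_i], so it is
   enough to treat one path: the joint distribution of its top and bottom
   contacts is symmetric, even when the number of its other east steps in each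
   row is prescribed.  For this, give a path the weight [z] per top contact,
   [z'] per bottom contact and [w_j] per remaining east step in row [j], and let
   [S l] be the weighted sum over the paths to the right of some column that
   start at height at least [l].  Exchanging [z] and [z'] does not fix [S l] in
   general, but it fixes [w_l S l - z (S l - S (l+1))] for [l] strictly inside
   the next column and [S l] for [l] at or below its bottom; this is preserved
   when a column is added on the left. *)

Set Implicit Arguments.
Unset Strict Implicit.
Unset Printing Implicit Defensive.

(** * Paths as sequences of heights of their east steps *)

Fixpoint heights (p : seq bool) : seq nat :=
  if p is b :: p' then
    if b then map succn (heights p') else 0 :: heights p'
  else [::].

Lemma size_heights p : size (heights p) = count_mem east p.
Proof. by elim: p => //= -[] p IH /=; rewrite ?size_map IH. Qed.

Lemma heights_le p : all (fun h => h <= count_mem north p) (heights p).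
Proof.
elim: p => //= -[] p IH /=; rewrite ?all_map ?add0n //.
Qed.

Lemma sorted_heights p : sorted leq (heights p).
Proof.
elim: p => //= -[] p IH /=.
  by rewrite sorted_map; apply: sub_sorted IH => a b.
by rewrite path_min_sorted //; apply/allP.
Qed.

(** North steps after the last east step leave no trace in [heights], hence the hypothesis on their
    number. *)
Lemma heights_inj p q :
  heights p = heights q -> count_mem north p = count_mem north q -> p = q.
Proof.
elim: p q => [|b p IH] [|c q] //=.
- by case: c => //=.
- by case: b => //=.
case: b; case: c => //=.
- by move=> /(inj_map succn_inj) E [F]; rewrite (IH q).
- by case: (heights p).
- by case: (heights q).
by case=> E; rewrite !add0n => F; rewrite (IH q).
Qed.

(** The first step is read off the head: a head 0 is an east step; a positive or missing head is a
    north step, after which all heights drop by one. *)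
Lemma heights_surj y s : sorted leq s -> all (fun h => h <= y) s ->
  exists2 p, heights p = s & count_mem north p = y.
Proof.
have [n] := ubnP (y + size s).
elim: n y s => // n IH [|y] [|[|h] s] //= ltn.
- by exists [::].
- move=> /path_sorted ss sy.
  have [|p Ep Ey] := IH 0 s _ ss sy; first by lia.
  by exists (east :: p); rewrite /= ?Ep ?Ey.
- move=> _ _; have [|p Ep <-] := IH y [::] _ isT isT; first by rewrite /=; lia.
  by exists (north :: p); rewrite /= ?Ep.
- move=> /path_sorted ss sy.
  have [|p <- <-] := IH y.+1 s _ ss sy; first by lia.
  by exists (east :: p).
move=> ss sy; pose s' := map predn s.
have Es : s = map succn s'.
  rewrite -map_comp -[LHS]map_id; apply/eq_in_map => i si /=.
  by have := allP (order_path_min leq_trans ss) _ si; lia.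
move: ss sy ltn; rewrite Es path_map all_map size_map => ss sy ltn.
have [|||p Ep <-] := IH y (h :: s').
- by rewrite /=; lia.
- by rewrite /=; apply: sub_path ss => a b /=.
- by move: sy; rewrite /= ltnS => /andP[-> ]; apply: sub_all => a /=.
by exists (north :: p); rewrite /= ?Ep.
Qed.

Lemma point_cons b p n : point (b :: p) n.+1 =
  ((point p n).1 + ~~ b, (point p n).2 + b).
Proof. by rewrite /point /= !(addnC _ (nat_of_bool _)); case: b. Qed.

Lemma points_cons b p :
  points (b :: p) = (0, 0) :: [seq (e.1 + ~~ b, e.2 + b) | e <- points p].
Proof.
rewrite /points [size _]/= -[iota 0 (size p).+2]/(0 :: iota 1 (size p).+1).
rewrite map_cons (iotaDl 1 0) -!map_comp; congr cons.
by apply: eq_map => n /=; rewrite -point_cons.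
Qed.

Lemma east_steps_cons b p : east_steps (b :: p) =
  (if b then [::] else [:: (0, 0)]) ++
  [seq (e.1 + ~~ b, e.2 + b) | e <- east_steps p].
Proof.
rewrite /east_steps -[iota 0 (size (b :: p))]/([:: 0] ++ iota 1 (size p)).
rewrite filter_cat map_cat; congr cat; first by case: b.
rewrite (iotaDl 1 0) filter_map -!map_comp.
by apply: eq_map => n /=; rewrite -point_cons.
Qed.

Lemma east_stepsE p : east_steps p =
  [seq (c, nth 0 (heights p) c) | c <- iota 0 (size (heights p))].
Proof.
elim: p => // b p IH; rewrite east_steps_cons {}IH -map_comp.
case: b => /=.
  rewrite size_map; apply/eq_in_map => c; rewrite mem_iota => /= cp.
  by rewrite addn0 addn1 (nth_map 0).
congr cons; rewrite (iotaDl 1 0) -map_comp; apply/eq_in_map => c _ /=.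
by rewrite addn0 addn1 add1n.
Qed.

Lemma mem_east_steps p c j : ((c, j) \in east_steps p) =
  (c < size (heights p)) && (nth 0 (heights p) c == j).
Proof.
rewrite east_stepsE; apply/mapP/andP => [[d]|[cp /eqP <-]].
  by rewrite mem_iota => /= dp [-> ->].
by exists c; rewrite ?mem_iota.
Qed.

Lemma mem_points p c j : ((c, j) \in points p) =
  [&& j <= count_mem north p, count (fun h => h < j) (heights p) <= c
    & c <= count (fun h => h <= j) (heights p)].
Proof.
elim: p c j => [|b p IH] c j.
  by rewrite /points /= inE xpair_eqE; case: c; case: j.
rewrite points_cons inE xpair_eqE.
have -> : ((c, j) \in [seq (e.1 + ~~ b, e.2 + b) | e <- points p]) =
    [&& ~~ b <= c, b <= j & (c - ~~ b, j - b) \in points p].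
  apply/mapP/and3P => [[[c' j'] /= cjp [-> ->]]|[bc bj cjp]].
    by rewrite !leq_addl !addnK.
  by exists (c - ~~ b, j - b); rewrite //= !subnK.
rewrite IH; case: b => /=.
- rewrite !count_map subn0; case: j => [|j] /=.
    have count0 (a : pred nat) : a =1 pred0 -> count a (heights p) = 0.
      by move/eq_count->; rewrite count_pred0.
    by rewrite !count0 // leqn0 !andbT orbF.
  by rewrite andbF /= subn1 add1n ltnS.
- rewrite subn0 add0n; case: c => [|c] /=.
    rewrite leqn0 addn_eq0 andbT orbF; case: j => [|j] /=; last by rewrite andbF.
    by rewrite (eq_count (a2 := pred0)) // count_pred0.
  rewrite subn1 /= add1n ltnS; case: j => [|j] //=.
  by rewrite (eq_count (a1 := fun h => h < 0) (a2 := pred0)) // count_pred0.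
Qed.

Lemma nth_heights_leq s c j : sorted leq s ->
  c < size s -> (nth 0 s c <= j) = (c < count (fun h => h <= j) s).
Proof.
elim: s c => //= h s IH c ss.
have count0 : j < h -> count (fun i => i <= j) s = 0.
  move=> jh; apply/eqP; rewrite -leqn0 leqNgt -has_count -all_predC.
  by apply: sub_all (order_path_min leq_trans ss) => i /=; lia.
case: c => [|c]; rewrite ?ltnS /=; first by case: (leqP h j) => // /count0 ->.
move=> cs; rewrite (IH c (path_sorted ss) cs).
by case: (leqP h j) => // /count0 ->.
Qed.

(** Both sides are compared with [forall j, cnt p j <= cnt q j], where [cnt r j] is the last
    abscissa of [r] in row [j]. For sorted heights, the numbers of entries at most [j] determine
    which single entries are at most [j]. *)
Lemma weakly_aboveE p q :
  count_mem east p = count_mem east q -> count_mem north p = count_mem north q ->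
  weakly_above p q = all2 leq (heights q) (heights p).
Proof.
move=> epq npq; pose cnt r j := count (fun h => h <= j) (heights r).
have sz : size (heights p) = size (heights q) by rewrite !size_heights.
have cntlt r j : count (fun h => h < j.+1) (heights r) = cnt r j by [].
have cnt_max r j : count_mem north r <= j -> cnt r j = count_mem east r.
  move=> rj; rewrite -size_heights; apply/eqP; rewrite -all_count.
  by apply: sub_all (heights_le r) => h /= /leq_trans; apply.
have pointP c j r : (c, j) \in points r -> c <= cnt r j.
  by rewrite mem_points => /and3P[].
have pointlast j r : j <= count_mem north r -> (cnt r j, j) \in points r.
  move=> jr; rewrite mem_points jr leqnn andbT /=.
  by apply: sub_count => h /=; apply: ltnW.
have waE : weakly_above p q <-> (forall j, cnt p j <= cnt q j).
  split=> [/hasPn wa j|le_cnt].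
    have [jp|/ltnW jp] := leqP j (count_mem north p); last first.
      by rewrite !cnt_max -?npq ?epq.
    have := wa _ (pointlast j p jp); rewrite negb_or => /andP[_ /allPn[[c i]]].
    move=> /pointP ci; rewrite negb_imply /= -leqNgt => /andP[/eqP ij].
    by rewrite ij in ci => /leq_trans; apply.
  apply/hasPn => -[c j] pcj; have := pcj; rewrite mem_points => /and3P[jp _ cj].
  rewrite negb_or; apply/andP; split; apply/allPn; last first.
    exists (cnt q j, j); first by apply: pointlast; rewrite -npq.
    by rewrite negb_imply eqxx /= -leqNgt; apply: leq_trans cj (le_cnt j).
  (* The witness is the lowest point of [q] on the vertical line through [c]; its row is the least
     [i] with [c <= cnt q i]. *)
  have ex : exists i, c <= cnt q i by exists j; apply: leq_trans cj (le_cnt j).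
  case: (ex_minnP ex) => i ci mini.
  have ij : i <= j by apply: mini; apply: leq_trans cj (le_cnt j).
  exists (c, i); last by rewrite negb_imply eqxx /= -leqNgt.
  rewrite mem_points -npq (leq_trans ij jp) [c <= _]ci andbT /=.
  case: i ci mini {ij} => [|i] ci mini.
    by rewrite (eq_count (a2 := pred0)) // count_pred0.
  by rewrite cntlt leqNgt; apply/negP => /ltnW/mini; rewrite ltnn.
apply/idP/idP => [/waE le_cnt|le_pq].
  rewrite all2E sz eqxx; apply/(all_nthP (0, 0)) => c; rewrite size_zip sz minnn => cq.
  rewrite nth_zip //= (nth_heights_leq _ (sorted_heights q)) //.
  apply: leq_trans (le_cnt _); rewrite -(nth_heights_leq _ (sorted_heights p)) //.
  by rewrite sz.
apply/waE => j; rewrite /cnt; elim: (heights p) (heights q) le_pq => [|h s IH] [|i r] //=.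
move=> /andP[ih /IH rs]; apply: leq_add => //.
by case: (leqP h j) => // hj; rewrite (leq_trans ih hj).
Qed.

(** * Enumeration of the height sequences between two boundaries *)

(** [j] bounds the first entry from below: it is the height in the preceding column, and the index
    [l] of the suffix sums [S l]. *)
Fixpoint fillings (ts bs : seq nat) (j : nat) : seq (seq nat) :=
  if (ts, bs) is (t :: ts', b :: bs') then
    flatten [seq [seq i :: s | s <- fillings ts' bs' i]
            | i <- iota j (t.+1 - j) & b <= i]
  else [:: [::]].

Lemma fillings_gt t b ts bs j : t < j -> fillings (t :: ts) (b :: bs) j = [::].
Proof. by rewrite /= -subn_eq0 => /eqP->. Qed.

Lemma fillings_le t b ts bs j : j <= t -> fillings (t :: ts) (b :: bs) j =
  (if b <= j then [seq j :: s | s <- fillings ts bs j] else [::]) ++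
  fillings (t :: ts) (b :: bs) j.+1.
Proof. by move=> jt; rewrite [LHS]/= subSn //=; case: leqP. Qed.

Lemma mem_fillings ts bs j s : size ts = size bs ->
  (s \in fillings ts bs j) = [&& path leq j s, all2 leq bs s & all2 leq s ts].
Proof.
elim: ts bs j s => [|t ts IH] [|b bs] j s //=; first by case: s => [|i s] /=; rewrite ?andbF.
move=> [sz]; apply/flatten_mapP/idP => [[i]|].
  rewrite mem_filter mem_iota => /and3P[bi ji it] /mapP[r].
  by rewrite (IH _ _ _ sz) => /and3P[ir br rt] -> /=; rewrite ji bi ir br rt; lia.
case: s => [|i s] //= /and3P[/andP[ji ir] /andP[bi br] /andP[it rt]].
exists i; first by rewrite mem_filter mem_iota bi ji; lia.
by apply/mapP; exists s; rewrite // (IH _ _ _ sz) ir br rt.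
Qed.

Lemma uniq_fillings ts bs j : uniq (fillings ts bs j).
Proof.
elim: ts bs j => [|t ts IH] [|b bs] j //.
have [n] := ubnP (t.+1 - j); elim: n j => // n IHn j ltn.
have [tj|jt] := ltnP t j; first by rewrite fillings_gt.
rewrite fillings_le // cat_uniq; apply/and3P; split.
- by case: ifP => // _; rewrite map_inj_uniq // => r s [].
- apply/hasPn => s; rewrite [fillings _ _ _]/= => /flatten_mapP[i].
  rewrite mem_filter mem_iota => /and3P[_ ji _] /mapP[r _ ->].
  by case: ifP => // _; apply/negP => /mapP[? _ [ij _]]; move: ji; rewrite ij ltnn.
by apply: IHn; lia.
Qed.

(** * Weighted sums over fillings and their symmetry *)

Section FillingSums.

Import GRing.Theory.
Local Open Scope ring_scope.

Variables (R : comNzRingType) (w : nat -> R).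
Implicit Types (z : R) (t b i j : nat) (ts bs s : seq nat).

(** The first two exponents are not exclusive: in a column with [t = b] the only cell touches both
    boundaries and weighs [z0 * z1]. *)
Definition cell_weight z0 z1 t b i : R :=
  z0 ^+ (i == t) * z1 ^+ (i == b) * w i ^+ (b < i < t)%N.

Definition filling_weight z0 z1 ts bs s : R :=
  \prod_(c < size s) cell_weight z0 z1 (nth 0 ts c)%N (nth 0 bs c)%N (nth 0 s c)%N.

Definition filling_sum z0 z1 ts bs j : R :=
  \sum_(s <- fillings ts bs j) filling_weight z0 z1 ts bs s.

Lemma filling_sum_gt z0 z1 t b ts bs j :
  (t < j)%N -> filling_sum z0 z1 (t :: ts) (b :: bs) j = 0.
Proof. by move=> tj; rewrite /filling_sum fillings_gt // big_nil. Qed.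

Lemma filling_sum_le z0 z1 t b ts bs j : (j <= t)%N ->
  filling_sum z0 z1 (t :: ts) (b :: bs) j =
  (if (b <= j)%N then cell_weight z0 z1 t b j * filling_sum z0 z1 ts bs j else 0)
  + filling_sum z0 z1 (t :: ts) (b :: bs) j.+1.
Proof.
move=> jt; rewrite /filling_sum fillings_le // big_cat; congr (_ + _).
case: ifP => _; last by rewrite big_nil.
rewrite big_map big_distrr; apply: eq_bigr => s _.
by rewrite /filling_weight big_ord_recl.
Qed.

(* For the suffix sums [S] of a region whose leftmost column is [[b, t]] and the
   sums [S'] obtained by exchanging [z] and [z']. *)
Definition swap_invariant z z' t b (S S' : nat -> R) : Prop :=
  [/\ forall l, (l <= b)%N -> S l = S' l,
      forall l, (b < l < t)%N ->
        w l * S l - z * (S l - S l.+1) = w l * S' l - z' * (S' l - S' l.+1)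
    & forall l, (l <= b)%N -> (l < t)%N ->
        z * (S l - S l.+1) = z' * (S' l - S' l.+1)].

Lemma swap_invariant_const z z' t b :
  swap_invariant z z' t b (fun=> 1) (fun=> 1).
Proof. by split=> *; rewrite ?subrr ?mulr0. Qed.

(** [S1] arises from [S] by adding the column [[b1, t1]] on the left. Inside it
    [S1 l - S1 l.+1 = w l * S l], so the combination to be preserved equals
    [w l * (S1 l - z * S l)], and it suffices that [S1 l - z * S l] is invariant. *)
Lemma swap_invariant_step z z' t b t1 b1 (S S' S1 S1' : nat -> R) :
  (b1 <= b)%N -> (t1 <= t)%N -> (b1 <= t1)%N ->
  (forall l, (t1 < l)%N -> S1 l = 0) ->
  (forall l, (t1 < l)%N -> S1' l = 0) ->
  (forall l, (l <= t1)%N -> S1 l =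
     (if (b1 <= l)%N then cell_weight z z' t1 b1 l * S l else 0) + S1 l.+1) ->
  (forall l, (l <= t1)%N -> S1' l =
     (if (b1 <= l)%N then cell_weight z' z t1 b1 l * S' l else 0) + S1' l.+1) ->
  swap_invariant z z' t b S S' -> swap_invariant z z' t1 b1 S1 S1'.
Proof.
move=> b1b t1t b1t1 S1_gt S1'_gt S1_le S1'_le [Ib Im It].
have wt_mid y y' l : (b1 < l < t1)%N -> cell_weight y y' t1 b1 l = w l.
  move=> /andP[bl lt]; rewrite /cell_weight bl lt (gtn_eqF bl) (ltn_eqF lt).
  by rewrite !mul1r.
have low l : (l < b1)%N -> S1 l = S1 l.+1 /\ S1' l = S1' l.+1.
  move=> lb; have lt : (l <= t1)%N by apply: leq_trans (ltnW lb) b1t1.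
  by rewrite S1_le // S1'_le // leqNgt lb !add0r.
(* No cell lies below row [b1], so [S1] and [S1'] are constant up to [b1]; only [b1] and the inside
   of the column matter. *)
suff atb : S1 b1 = S1' b1 /\ ((b1 < t1)%N ->
    z * (S1 b1 - S1 b1.+1) = z' * (S1' b1 - S1' b1.+1) /\
    forall l, (b1 < l < t1)%N ->
        w l * S1 l - z * (S1 l - S1 l.+1) = w l * S1' l - z' * (S1' l - S1' l.+1)).
  have below l : (l <= b1)%N -> S1 l = S1' l.
    move=> lb; rewrite -(subKn lb); elim: (b1 - l)%N (leq_subr l b1) => [|d IH] db.
      by rewrite subn0; case: atb.
    have [|-> ->] := low (b1 - d.+1)%N; first by lia.
    have -> : (b1 - d.+1).+1 = (b1 - d)%N by lia.
    by apply: IH; lia.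
  split=> // [l blt|l]; first by apply: (atb.2 _).2 => //; lia.
  rewrite leq_eqVlt => /predU1P[->|lb] lt; first exact: (atb.2 lt).1.
  by have [<- <-] := low l lb; rewrite !subrr !mulr0.
(* In a column of one cell the weight [z * z'] is already symmetric, and [S b1] is invariant because
   [b1 <= b]. *)
have [E|bt] : (b1 = t1)%N \/ (b1 < t1)%N by lia.
  rewrite E ltnn; split=> //.
  rewrite S1_le // S1'_le // -E leqnn E S1_gt // S1'_gt // Ib; last by lia.
  by rewrite -E /cell_weight eqxx ltnn !expr1 !expr0; ring.
(* The inside of the new column may reach down below the old one; in rows up to [b] the first and
   third relations give the second. *)
have symS l : (b1 < l < t1)%N ->
    w l * S l - z * (S l - S l.+1) = w l * S' l - z' * (S' l - S' l.+1).
  move=> /andP[bl lt]; have [lb|lb] := leqP l b; last by apply: Im; lia.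
  by rewrite (It l lb) ?(Ib l lb) //; lia.
(* The combinations that are unchanged by the exchange telescope. *)
have symD l : (b1 < l <= t1)%N -> S1 l - z * S l = S1' l - z' * S' l.
  move=> /andP[bl lt]; rewrite -(subKn lt).
  have: (t1 - l < t1 - b1)%N by lia.
  elim: (t1 - l)%N => [_|d IH db].
    rewrite subn0 S1_le // S1'_le // ltnW // S1_gt // S1'_gt //.
    by rewrite /cell_weight eqxx gtn_eqF // ltnn andbF !expr1 !expr0; ring.
  have {IH} := IH (ltnW db); set m := (t1 - d.+1)%N.
  have -> : (t1 - d)%N = m.+1 by rewrite /m; lia.
  have mbt : (b1 < m < t1)%N by rewrite /m; lia.
  move=> IH; have := symS m mbt.
  rewrite (S1_le m) ?(S1'_le m); try by lia.
  rewrite !wt_mid // (ltnW (proj1 (andP mbt))) => E.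
  have -> : w m * S m + S1 m.+1 - z * S m =
    (S1 m.+1 - z * S m.+1) + (w m * S m - z * (S m - S m.+1)) by ring.
  by rewrite IH E; ring.
have wt_bot y y' : cell_weight y y' t1 b1 b1 = y'.
  by rewrite /cell_weight eqxx ltnn ltn_eqF // !expr0 expr1; ring.
have f1 : S1 b1 = z' * S b1 + S1 b1.+1.
  by rewrite S1_le ?leqnn ?wt_bot // ltnW.
have f1' : S1' b1 = z * S' b1 + S1' b1.+1.
  by rewrite S1'_le ?leqnn ?wt_bot // ltnW.
have Ebot : S b1 = S' b1 by apply: Ib.
split=> [|_]; last split.
- have := symD b1.+1; rewrite ltnSn bt => /(_ isT) D.
  have := It b1 b1b (leq_trans bt t1t) => E.
  (* Each summand is invariant: the first by [symD], the second because [z + z'] is symmetric and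
     [S b1 = S' b1], the third by [It]. *)
  have -> : S1 b1 = (S1 b1.+1 - z * S b1.+1) + (z + z') * S b1
    - z * (S b1 - S b1.+1) by rewrite f1; ring.
  by rewrite D E Ebot f1'; ring.
(* Both sides equal [z * z' * S b1]. *)
- by rewrite f1 f1' Ebot; ring.
move=> l blt; have D := symD l; move: (blt) => /andP[bl lt].
rewrite (S1_le l) ?(S1'_le l) in D *; try by lia.
rewrite !wt_mid // (ltnW bl) in D *.
have {}D := D ltac:(lia).
set u := w l * S l + _ in D *; set u' := w l * S' l + _ in D *.
have -> : w l * u - z * (u - S1 l.+1) = w l * (u - z * S l) by rewrite /u; ring.
by rewrite D /u'; ring.
Qed.

Lemma filling_sum_invariant z z' t b ts bs :
  path leq t ts -> path leq b bs -> all2 leq (b :: bs) (t :: ts) ->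
  swap_invariant z z' t b (filling_sum z z' (t :: ts) (b :: bs))
    (filling_sum z' z (t :: ts) (b :: bs)).
Proof.
elim: ts t b bs => [|t' ts IH] t b [|b' bs] //=; rewrite ?andbF ?andbT //.
  move=> _ _ bt.
  have sum1 y y' l : filling_sum y y' [::] [::] l = 1.
    by rewrite /filling_sum big_seq1 /filling_weight big_ord0.
  (* The empty region has constant sum 1, which is invariant for every column, so the last column is
     added next to a copy of itself. *)
  apply: (swap_invariant_step (leqnn b) (leqnn t) bt) (swap_invariant_const z z' t b);
    try by [move=> l; apply: filling_sum_gt].
  - by move=> l lt; rewrite filling_sum_le // sum1.
  - by move=> l lt; rewrite filling_sum_le // sum1.
move=> /andP[tt' sts] /andP[bb' sbs] /and3P[bt bt' bts].
apply: (swap_invariant_step bb' tt' bt) (IH _ _ _ sts sbs _); rewrite /= ?bt' //;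
  by move=> l; (apply: filling_sum_gt || apply: filling_sum_le).
Qed.

Lemma filling_sum_swap z z' ts bs :
  sorted leq ts -> sorted leq bs -> all2 leq bs ts ->
  filling_sum z z' ts bs 0 = filling_sum z' z ts bs 0.
Proof.
case: ts bs => [|t ts] [|b bs] //=.
  by rewrite /filling_sum !big_seq1 /filling_weight !big_ord0.
by move=> sts sbs le; have [-> //] := filling_sum_invariant z z' sts sbs le.
Qed.

End FillingSums.

(** * From equal counts to a bijection *)

(** [phi] sends [p] to the element whose rank in the [f]-fiber over [g p] is the rank of [p] in the
    [g]-fiber over the same value. *)
Lemma equinumerous_fibers_bij (aT : finType) (K : eqType) (A : {set aT})
    (f g : aT -> K) :
  (forall v, #|[set p in A | f p == v]| = #|[set p in A | g p == v]|) ->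
  exists phi : aT -> aT, {in A &, injective phi} /\
    {in A, forall p, phi p \in A /\ f (phi p) = g p}.
Proof.
move=> card_fib; pose fib h p := enum [set q in A | h q == g p].
pose phi p := nth p (fib f p) (index p (fib g p)).
have mem_fib p : p \in A -> p \in fib g p by rewrite mem_enum inE eqxx andbT.
have lt_fib p : p \in A -> index p (fib g p) < size (fib f p).
  by move=> Ap; rewrite -cardE card_fib cardE index_mem mem_fib.
have phiP p : p \in A -> phi p \in A /\ f (phi p) = g p.
  move=> Ap; have := mem_nth p (lt_fib p Ap).
  by rewrite mem_enum inE => /andP[? /eqP].
exists phi; split=> // p q Ap Aq Epq.
have Eg : g p = g q by rewrite -(phiP p Ap).2 -(phiP q Aq).2 Epq.
have Efib h : fib h p = fib h q by rewrite /fib Eg.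
move: Epq; rewrite /phi !Efib (set_nth_default q) -?Efib ?lt_fib //.
move/eqP; rewrite Efib nth_uniq ?enum_uniq -?Efib ?lt_fib //; last first.
  by rewrite !Efib lt_fib.
move/eqP; rewrite !Efib => /(congr1 (nth p (fib g q))).
by rewrite !nth_index ?mem_fib // -Efib mem_fib.
Qed.

(** * Exchange of the top and bottom contacts of one path *)

Section Paths.

Variables x y : nat.
Implicit Types P Q T B : lpath x y.

Definition height (p : seq bool) c := nth 0 (heights p) c.

Lemma count_east P : count_mem east P = x.
Proof. by case: P => p /= /eqP. Qed.

Lemma count_north P : count_mem north P = y.
Proof.
have /(congr1 (addn^~ (count_mem north P))) := count_east P.
have -> : count_mem north P = count (predC (pred1 east)) P.
  by apply: eq_count => -[].
by rewrite count_predC size_tuple => /addnI.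
Qed.

Lemma size_heights_lpath P : size (heights P) = x.
Proof. by rewrite size_heights count_east. Qed.

Lemma height_default P c : x <= c -> height P c = 0.
Proof. by move=> xc; rewrite /height nth_default ?size_heights_lpath. Qed.

Lemma height_le P c : height P c <= y.
Proof.
have [cx|/(height_default P)-> //] := ltnP c x.
have := all_nthP 0 (heights_le P) c; rewrite count_north; apply.
by rewrite size_heights_lpath.
Qed.

Lemma lpath_heights_inj : injective (fun P => heights P).
Proof.
move=> P Q E; do 2![apply: val_inj].
by apply: heights_inj E _; rewrite !count_north.
Qed.

Lemma lpath_heights_surj s : size s = x -> sorted leq s ->
  all (fun h => h <= y) s -> exists P, heights P = s.
Proof.
move=> sx ss sy; have [p Ep Ny] := heights_surj ss sy.
have Ex : count_mem east p = x by rewrite -size_heights Ep.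
have sp : size p == x + y.
  by rewrite -(count_predC (pred1 east)) Ex -Ny eqn_add2l; apply/eqP/eq_count => -[].
have cp : count_mem east (Tuple sp) == x by rewrite Ex.
by exists (LPath cp).
Qed.

Lemma weakly_above_all2 P Q : weakly_above P Q = all2 leq (heights Q) (heights P).
Proof. by rewrite weakly_aboveE // ?count_east ?count_north. Qed.

Lemma weakly_aboveP P Q :
  reflect (forall c, height Q c <= height P c) (weakly_above P Q).
Proof.
rewrite weakly_above_all2 all2E !size_heights_lpath eqxx /=.
apply: (iffP (all_nthP (0, 0))) => [le c | le c].
  have [cx|xc] := ltnP c x; last by rewrite !height_default.
  have := le c; rewrite size_zip !size_heights_lpath minnn nth_zip //.
    by apply.
  by rewrite !size_heights_lpath.
by move=> _; rewrite nth_zip ?size_heights_lpath //; apply: le.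
Qed.

Lemma weakly_above_trans : transitive (fun P Q => weakly_above P Q).
Proof.
move=> Q P R /weakly_aboveP PQ /weakly_aboveP QR.
by apply/weakly_aboveP => c; apply: leq_trans (QR c) (PQ c).
Qed.

Lemma heights_pathsTB T B :
  perm_eq [seq heights (P : lpath x y) | P <- enum (pathsTB T B)]
    (fillings (heights T) (heights B) 0).
Proof.
have sz : size (heights T) = size (heights B) by rewrite !size_heights_lpath.
apply: uniq_perm; rewrite ?uniq_fillings //.
  by rewrite map_inj_uniq ?enum_uniq //; apply: lpath_heights_inj.
move=> s; rewrite mem_fillings //.
have -> : path leq 0 s = sorted leq s.
  by rewrite (path_sortedE leq_trans); apply/andb_idl => _; apply/allP.
apply/mapP/and3P => [[P]|[ss Bs sT]].
  rewrite mem_enum inE !weakly_above_all2 => /andP[BP PT] ->.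
  by split=> //; apply: sorted_heights.
have [||| P EP] := @lpath_heights_surj s => //.
- by move: Bs; rewrite all2E size_heights_lpath => /andP[/eqP].
- move: sT; rewrite all2E size_heights_lpath => /andP[/eqP szs].
  move/(all_nthP (0, 0)) => sT; apply/(all_nthP 0) => c cs.
  have := sT c; rewrite size_zip size_heights_lpath {1}szs minnn -{1}szs.
  rewrite nth_zip ?size_heights_lpath // => /(_ cs) /leq_trans; apply.
  exact: height_le.
by exists P; rewrite // mem_enum inE !weakly_above_all2 EP Bs sT.
Qed.

Definition contacts P Q := #|[set c : 'I_x | height P c == height Q c]|.

Definition inner_steps T B P j :=
  #|[set c : 'I_x | (height B c < height P c < height T c) && (height P c == j)]|.

Section Monomials.

Import GRing.Theory Num.Theory.
Local Open Scope ring_scope.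

(** Variable 0 marks top contacts, 1 bottom contacts and [j.+2] the inner steps in row [j]; rows run
    from 0 to [y], whence [y.+3] variables. *)
Let top_var : 'I_y.+3 := ord0.
Let bot_var : 'I_y.+3 := inord 1.
Let row_var (j : nat) : 'I_y.+3 := inord j.+2.

Definition cell_monomial (v v' : 'I_y.+3) (t b h : nat) : 'X_{1..y.+3} :=
  (U_(v) *+ (h == t) + U_(v') *+ (h == b) + U_(row_var h) *+ (b < h < t)%N)%MM.

Definition path_monomial v v' T B P : 'X_{1..y.+3} :=
  (\sum_(c < x) cell_monomial v v' (height T c) (height B c) (height P c))%MM.

Lemma filling_weight_monomial v v' T B P :
  filling_weight (fun j => 'X_(row_var j) : {mpoly int[y.+3]}) 'X_v 'X_v'
    (heights T) (heights B) (heights P) = 'X_[path_monomial v v' T B P].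
Proof.
rewrite /filling_weight size_heights_lpath /path_monomial -mprodXE.
by apply: eq_bigr => c _; rewrite /cell_weight !mpolyXn -!mpolyXD.
Qed.

Lemma filling_sum_monomial v v' T B :
  filling_sum (fun j => 'X_(row_var j) : {mpoly int[y.+3]}) 'X_v 'X_v'
    (heights T) (heights B) 0 =
  \sum_(P in pathsTB T B) 'X_[path_monomial v v' T B P].
Proof.
rewrite /filling_sum -(perm_big _ (heights_pathsTB T B)) big_map big_enum /=.
by apply: eq_bigr => P _; apply: filling_weight_monomial.
Qed.

(** The coefficient of ['X_[m]] in the weighted sum counts the paths with monomial [m], and the sum
    is fixed by exchanging the two contact variables. *)
Lemma card_path_monomial T B m : weakly_above T B ->
  #|[set P in pathsTB T B | path_monomial top_var bot_var T B P == m]| =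
  #|[set P in pathsTB T B | path_monomial bot_var top_var T B P == m]|.
Proof.
rewrite weakly_above_all2 => BT.
have coef v v' : ((\sum_(P in pathsTB T B) 'X_[path_monomial v v' T B P]
    : {mpoly int[y.+3]})@_m =
  #|[set P in pathsTB T B | path_monomial v v' T B P == m]|%:R).
  rewrite raddf_sum -sum1_card natr_sum big_mkcond [RHS]big_mkcond /=.
  apply: eq_bigr => P _; rewrite [in RHS]inE mcoeffX.
  by case: (P \in _) => //; case: eqP.
apply/eqP; rewrite -(eqr_nat int) -!coef -!filling_sum_monomial.
by rewrite (filling_sum_swap _ _ _ (sorted_heights T) (sorted_heights B) BT).
Qed.

Lemma path_monomial_var v v' T B P (i : 'I_y.+3) :
  path_monomial v v' T B P i =
  ((v == i) * contacts P T + (v' == i) * contacts P B +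
    (1 < i) * inner_steps T B P i.-2)%N.
Proof.
rewrite /path_monomial mnm_sumE /contacts /inner_steps -!sum1dep_card.
rewrite !(big_mkcond (fun c => _ == _)) (big_mkcond (fun c => _ && _)) /=.
rewrite !big_distrr -!big_split; apply: eq_bigr => c _ /=.
rewrite !mnmDE !mulmnE !mnm1E; congr (_ * _ + _ * _ + _)%N; try by case: eqP.
rewrite mulnC -val_eqE /= inordK ?ltnS ?height_le //.
case: (_ < _ < _)%N; rewrite ?muln0 //= mul1n.
by case: i => -[|[|i]] //= _; rewrite !eqSS mul1n; case: eqP.
Qed.

End Monomials.

Lemma contacts_swap_bij T B : weakly_above T B ->
  exists phi : lpath x y -> lpath x y, {in pathsTB T B &, injective phi} /\
    {in pathsTB T B, forall P, [/\ phi P \in pathsTB T B,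
       contacts (phi P) T = contacts P B, contacts (phi P) B = contacts P T
     & forall j, inner_steps T B (phi P) j = inner_steps T B P j]}.
Proof.
move=> TB.
have [phi [inj_phi phiP]] :=
  equinumerous_fibers_bij (fun m => card_path_monomial m TB).
exists phi; split=> // P /phiP[phiA /mnmP E]; split=> //.
- have := E ord0; rewrite !path_monomial_var -!val_eqE /= inordK //=.
  by rewrite !mul0n !mul1n !addn0.
- have := E (inord 1); rewrite !path_monomial_var -!val_eqE /= inordK //=.
  by rewrite !mul0n !mul1n !addn0.
(* Rows above [y] have no variable of their own, but no path has a step there. *)
move=> j; have [jy|yj] := ltnP j y.+1; last first.
  have none Q : inner_steps T B Q j = 0.
    apply: eq_card0 => c; rewrite !inE; apply/negP => /andP[_ /eqP Qj].
    by have := height_le Q c; rewrite Qj leqNgt yj.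
  by rewrite !none.
have := E (inord j.+2); rewrite !path_monomial_var inordK ?ltnS //.
by rewrite -!val_eqE /= !inordK ?ltnS // !mul0n !mul1n.
Qed.

End Paths.

(** * Tuples of paths and the exchange of adjacent statistics *)

Section Tuples.

Variables (x y : nat) (T B : lpath x y) (k : nat).
Hypothesis TB : weakly_above T B.
Implicit Types (P : k.-tuple (lpath x y)) (Q : lpath x y).

Lemma contactsC Q R : contacts Q R = contacts R Q.
Proof. by apply: eq_card => c; rewrite !inE eq_sym. Qed.

Lemma hstat_contacts P i :
  hstat T B P i = contacts (pathi T B P i) (pathi T B P i.+1).
Proof.
rewrite /hstat; move: (pathi _ _ _ _) (pathi _ _ _ _) => R Q.
rewrite (east_stepsE R) count_map size_heights_lpath -sum1_count.
have -> : iota 0 x = index_iota 0 x by rewrite /index_iota subn0.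
rewrite big_mkord sum1dep_card.
apply: eq_card => c; rewrite !inE /= mem_east_steps size_heights_lpath ltn_ord.
by rewrite eq_sym.
Qed.

Lemma strictly_between_height c j : c < x ->
  strictly_between T B (c, j) = (height B c < j < height T c).
Proof.
move=> cx; have has_step Q (a : pred nat) :
    has (fun t => (t.1 == c) && a t.2) (east_steps Q) = a (height Q c).
  rewrite east_stepsE has_map size_heights_lpath; apply/hasP/idP => /=.
    by case=> d _ /andP[/eqP-> ].
  by exists c; rewrite ?mem_iota //= eqxx.
by rewrite /strictly_between (has_step T (ltn j)) (has_step B (gtn j)) andbC.
Qed.

(** By transitivity, a sorted tuple with all members between [T] and [B] is a chain from [T] to [B];
    the pair [T], [B] itself is covered by [TB]. *)
Lemma mem_tuplesTB P : (P \in tuplesTB T B k) =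
  path (fun Q R : lpath x y => weakly_above Q R) T (rcons P B).
Proof.
have tr := @weakly_above_trans x y.
rewrite inE (path_pairwise tr) (sorted_pairwise tr) /= pairwise_rcons all_rcons TB.
rewrite /= andbA -all_predI; congr andb; apply: eq_all => Q.
by rewrite /= inE andbC.
Qed.

Lemma mem_tuplesTBP P : reflect
  (forall l, l <= k -> weakly_above (pathi T B P l) (pathi T B P l.+1))
  (P \in tuplesTB T B k).
Proof.
rewrite mem_tuplesTB; apply: (iffP (pathP B)) => /= wa l lk; apply: wa.
  by rewrite size_rcons size_tuple ltnS.
by move: lk; rewrite size_rcons size_tuple ltnS.
Qed.

Lemma pathi_tnth P (l : 'I_k) : pathi T B P l.+1 = tnth P l.
Proof.
by rewrite /pathi /= nth_rcons size_tuple ltn_ord (tnth_nth B).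
Qed.

(** Index [k.+1] is the appended [B]; larger indices give the default value of [nth], again [B]. *)
Lemma pathi_last P l : k < l -> pathi T B P l = B.
Proof.
case: l => // l; rewrite ltnS leq_eqVlt /pathi /= nth_rcons size_tuple.
by case: ltngtP => // _ _; case: eqP.
Qed.

Lemma height_pathi_mono P l m c : P \in tuplesTB T B k -> l <= m ->
  height (pathi T B P m) c <= height (pathi T B P l) c.
Proof.
move=> /mem_tuplesTBP wa /subnK <-; elim: (m - l) => // d IH.
apply: leq_trans IH; rewrite addSn; have [dk|kd] := leqP (d + l) k.
  by have /weakly_aboveP := wa _ dk.
by rewrite !pathi_last // ltnW.
Qed.

(** Tuple indices start at 0, so the replaced path is [pathi T B P i.+1], with neighbours at [i] and
    [i.+2]. *)
Definition set_path P (i : 'I_k) Q : k.-tuple (lpath x y) :=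
  [tuple if l == i then Q else tnth P l | l < k].

Lemma pathi_set P i Q l :
  pathi T B (set_path P i Q) l = if l == i.+1 then Q else pathi T B P l.
Proof.
have [kl|] := ltnP k l.
  by rewrite !pathi_last // gtn_eqF // (leq_ltn_trans (ltn_ord i) kl).
case: l => // l lk; rewrite -[l.+1]/((Ordinal lk).+1) !pathi_tnth tnth_mktuple.
by rewrite eqSS.
Qed.

(** The right-hand side ignores the path of index [i], so changing that path while keeping its inner
    steps in each row keeps [ustat]. The columns counted there are split by whether that path runs
    at height [y - s]. *)
Lemma ustat_inner_steps P (i : 'I_k) s : P \in tuplesTB T B k ->
  ustat T B P s +
    inner_steps (pathi T B P i) (pathi T B P i.+2) (tnth P i) (y - s) =
  #|[set c : 'I_x | (height B c < y - s < height T c) &&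
       [forall l, (l != i) ==> (height (tnth P l) c != y - s)]]|.
Proof.
move=> PTB; set j := y - s; set A := [set c : 'I_x | _ && [forall l, _]].
rewrite -(cardsID [set c : 'I_x | height (tnth P i) c == j] A) addnC.
congr addn; apply: eq_card => c; rewrite !inE; last first.
  rewrite strictly_between_height ?ltn_ord // andbCA; congr andb.
  apply/hasPn/andP => [unused|[unusedi /forallP unused] Q /tnthP[l ->]].
    have U l : height (tnth P l) c != j.
      have := unused _ (mem_tnth l P); rewrite mem_east_steps size_heights_lpath.
      by rewrite ltn_ord.
    by split; [apply: U | apply/forallP => l; apply/implyP].
  rewrite mem_east_steps size_heights_lpath ltn_ord /=.
  have [->|li] := eqVneq l i; first exact: unusedi.
  by have /implyP := unused l; apply.
have mono l m : l <= m -> height (pathi T B P m) c <= height (pathi T B P l) c.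
  exact: height_pathi_mono.
rewrite andbC [RHS]andbC; case: eqP => //= Ej.
rewrite Ej; have Ei := pathi_tnth P i.
have T0 : pathi T B P 0 = T by [].
have Bk : pathi T B P k.+1 = B by apply: pathi_last.
apply/andP/andP => [[inB inT]|[/andP[jB jT] /forallP unused]].
  split.
    have hT : height (pathi T B P i) c <= height T c := mono 0 i isT.
    have hB : height B c <= height (pathi T B P i.+2) c.
      by rewrite -[in X in X <= _]Bk; apply/mono/ltn_ord.
    by rewrite (leq_ltn_trans hB inB) (leq_trans inT hT).
  apply/forallP => l; apply/implyP => li; rewrite -pathi_tnth neq_ltn.
  have [lt|gt] : l < i \/ i < l by move: li; rewrite neq_ltn => /orP.
    by rewrite (leq_trans inT) ?orbT // mono.
  by rewrite (leq_ltn_trans _ inB) // mono.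
have unused' l (lk : l < k) : l != i -> height (pathi T B P l.+1) c != j.
  move=> li; rewrite -[l.+1]/((Ordinal lk).+1) pathi_tnth.
  by have /implyP := unused (Ordinal lk); apply.
have le1 := mono i.+1 i.+2 (leqnSn _); have le2 := mono i i.+1 (leqnSn _).
(* A neighbour is either another path of the tuple, which avoids this step, or one of [T] and [B],
   between which the step lies strictly. *)
rewrite Ei Ej in le1 le2; rewrite ![_ < _]ltn_neqAle le1 le2 !andbT; split.
  have [lk|] := ltnP i.+1 k; first by rewrite unused' // gtn_eqF.
  move=> ki; have -> : i.+2 = k.+1 by have := ltn_ord i; lia.
  by rewrite Bk ltn_eqF.
case: (nat_of_ord i) (ltn_ord i) unused' => [|i'] ik unused'.
  by rewrite T0 ltn_eqF.
by rewrite eq_sym unused' ?ltn_eqF // ltnW.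
Qed.

(** The path of index [i] is moved by the exchange of contacts in the region between its neighbours.
    The neighbours stay, so the region is recovered from the image and injectivity follows. *)
Lemma adjacent_swap_bij u (i : 'I_k) :
  exists Phi : k.-tuple (lpath x y) -> k.-tuple (lpath x y),
    {in tuplesTBu T B k u &, injective Phi} /\
    {in tuplesTBu T B k u, forall P, Phi P \in tuplesTBu T B k u /\
      forall l : 'I_k.+1, hstat T B (Phi P) l =
        hstat T B P (tperm (widen_ord (leqnSn k) i) (lift ord0 i) l)}.
Proof.
pose swaps (D : lpath x y * lpath x y) (f : lpath x y -> lpath x y) : Prop :=
  weakly_above D.1 D.2 -> {in pathsTB D.1 D.2 &, injective f} /\
  {in pathsTB D.1 D.2, forall Q, [/\ f Q \in pathsTB D.1 D.2,
     contacts (f Q) D.1 = contacts Q D.2, contacts (f Q) D.2 = contacts Q D.1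
   & forall j, inner_steps D.1 D.2 (f Q) j = inner_steps D.1 D.2 Q j]}.
(* One exchange is chosen for each pair of boundaries; for a pair in the wrong order the requirement
   is void. *)
have [phi phiP] : exists phi, forall D, swaps D (phi D).
  apply: (@fin_all_exists _ (fun=> lpath x y -> lpath x y) swaps) => -[T' B'].
  case: (boolP (weakly_above T' B')) => [/contacts_swap_bij[f fP]|nTB].
    by exists f.
  by exists id => /= TB'; rewrite TB' in nTB.
pose T' P := pathi T B P i; pose B' P := pathi T B P i.+2.
pose new P := phi (T' P, B' P) (tnth P i).
pose Phi P := set_path P i (new P).
have T'_Phi P : T' (Phi P) = T' P by rewrite /T' pathi_set ltn_eqF.
have B'_Phi P : B' (Phi P) = B' P by rewrite /B' pathi_set gtn_eqF.
have local P : P \in tuplesTB T B k ->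
    weakly_above (T' P) (B' P) /\ tnth P i \in pathsTB (T' P) (B' P).
  move=> /mem_tuplesTBP wa; have wa1 := wa i (ltnW (ltn_ord i)).
  have wa2 := wa i.+1 (ltn_ord i).
  by rewrite inE -pathi_tnth wa1 wa2; split; first apply: weakly_above_trans wa1 wa2.
have tnth_Phi P : tnth (Phi P) i = new P by rewrite tnth_mktuple eqxx.
exists Phi; split=> [P P'|P].
  move=> /setIdP[/local[wa PTB] _] /setIdP[/local[_ PTB'] _] E.
  have ET : T' P = T' P' by rewrite -T'_Phi E T'_Phi.
  have EB : B' P = B' P' by rewrite -B'_Phi E B'_Phi.
  have Ei : tnth P i = tnth P' i.
    apply: (phiP (T' P, B' P) wa).1 => //; first by rewrite /= ET EB.
    by rewrite -/(new P) -tnth_Phi E tnth_Phi /new ET EB.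
  apply: eq_from_tnth => l; have [->//|li] := eqVneq l i.
  by have := congr1 (fun t => tnth t l) E; rewrite !tnth_mktuple (negbTE li).
move=> /setIdP[PTB uP]; have [waP PTB'] := local P PTB.
have [newTB newT newB new_inner] := (phiP (T' P, B' P) waP).2 _ PTB'.
rewrite /= -/(new P) in newTB newT newB new_inner.
have PhiTB : Phi P \in tuplesTB T B k.
  apply/mem_tuplesTBP => l lk; rewrite !pathi_set eqSS.
  have {}lk := mem_tuplesTBP _ PTB l lk.
  move: newTB; rewrite inE => /andP[nB nT].
  have [->|li] := eqVneq l i.+1; first by rewrite gtn_eqF.
  by have [->|] := eqVneq l i.
split.
  apply/setIdP; split; rewrite // -(eqP uP); apply/eqP/eq_map => s.
  apply/eqP; rewrite -(eqn_add2r (inner_steps (T' P) (B' P) (tnth P i) (y - s))).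
  rewrite ustat_inner_steps // -new_inner -T'_Phi -B'_Phi -tnth_Phi.
  rewrite ustat_inner_steps //; apply/eqP/eq_card => c; rewrite !inE.
  congr andb; apply: eq_forallb => l; rewrite tnth_mktuple.
  by case: eqP.
move=> l; rewrite !hstat_contacts !pathi_set eqSS.
(* Only the statistics [i] and [i.+1] involve the moved path: they are its contacts with the upper
   and lower neighbour, which trade places. *)
case: tpermP => [->|->|li li1] /=.
- by rewrite ltn_eqF // eqxx contactsC newT pathi_tnth.
- by rewrite /bump /= add1n eqxx gtn_eqF // newB contactsC pathi_tnth.
have -> : (l == i.+1 :> nat) = false.
  by apply/eqP => E; apply: li1; apply: val_inj; rewrite /= /bump add1n.
by have -> : (l == i :> nat) = false by apply/eqP => E; apply: li; apply: val_inj.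
Qed.

End Tuples.

(** * Reduction of all permutations to adjacent transpositions *)

(** Transpositions generate, and [tperm i j] is the conjugate of [tperm i1 j] by [tperm i i1], where
    [i1] is the successor of [i]; this allows induction on [j - i]. *)
Lemma tperm_adjacent_ind k (A : {perm 'I_k.+1} -> Prop) :
  A 1%g -> (forall s t, A s -> A t -> A (s * t)%g) ->
  (forall i : 'I_k, A (tperm (widen_ord (leqnSn k) i) (lift ord0 i))) ->
  forall s, A s.
Proof.
move=> A1 AM Aadj.
have Alt (i j : 'I_k.+1) : i < j -> A (tperm i j).
  have [n] := ubnP (j - i); elim: n i j => // n IH i j ltn ij.
  have ik : i < k by apply: leq_trans ij _; rewrite -ltnS.
  have Ei : i = widen_ord (leqnSn k) (Ordinal ik) by apply: val_inj.
  set i1 := lift ord0 (Ordinal ik); have i1E : i1 = i.+1 :> nat by [].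
  have Ai : A (tperm i i1) by rewrite {1}Ei; apply: Aadj.
  have [<-//|ji1] := eqVneq i1 j.
  have i1j : i1 < j by rewrite ltn_neqAle val_eqE ji1.
  have nij : i != j by rewrite -val_eqE /= ltn_eqF.
  have -> : tperm i j = (tperm i i1 * tperm i1 j * tperm i i1)%g.
    have := tpermJ i1 j (tperm i i1).
    rewrite tpermR (tpermD nij ji1) => <-.
    by rewrite /conjg tpermV mulgA.
  by apply: (AM) => //; apply: AM => //; apply: IH => //; rewrite i1E; lia.
move=> s; have [ts -> _] := prod_tpermP s.
elim/big_rec: _ => // t s' _; apply: AM.
have [lt|lt|/val_inj->] := ltngtP t.1 t.2; first exact: Alt.
  by rewrite tpermC; apply: Alt.
by rewrite tperm1.
Qed.

Theorem theorem5p1 (x y : nat) (T B : lpath x y) (hTB : weakly_above T B)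
    (k : nat) (hk : 0 < k) (u : seq nat) (pi : {perm 'I_k.+1}) :
  (\sum_(P in tuplesTBu T B k u) \prod_(i < k.+1) 'X_i ^+ hstat T B P i =
   \sum_(P in tuplesTBu T B k u) \prod_(i < k.+1) 'X_i ^+ hstat T B P (pi i)
     :> {mpoly int[k.+1]})%R.
Proof.
pose h (P : k.-tuple (lpath x y)) := [ffun i : 'I_k.+1 => hstat T B P i].
pose A := tuplesTBu T B k u.
(* An arbitrary function [F] of the vector of statistics makes products work: for [s * t], the case
   of [t] is applied to [F] composed with the action of [s]. *)
suff sym (F : {ffun 'I_k.+1 -> nat} -> {mpoly int[k.+1]}) :
    (\sum_(P in A) F (h P) = \sum_(P in A) F [ffun i => h P (pi i)])%R.
  pose F (g : {ffun 'I_k.+1 -> nat}) : {mpoly int[k.+1]} :=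
    (\prod_(i < k.+1) 'X_i ^+ g i)%R.
  transitivity (\sum_(P in A) F (h P))%R.
    by apply: eq_bigr => P _; apply: eq_bigr => i _; rewrite ffunE.
  by rewrite sym; apply: eq_bigr => P _; apply: eq_bigr => i _; rewrite !ffunE.
elim/tperm_adjacent_ind: pi F => [F|s t IHs IHt F|i F].
- by apply: eq_bigr => P _; congr F; apply/ffunP => i; rewrite !ffunE perm1.
- rewrite IHs (IHt (fun g => F [ffun i => g (s i)])).
  apply: eq_bigr => P _; congr F; apply/ffunP => i.
  by rewrite !ffunE permM.
have [Phi [inj_Phi PhiP]] := adjacent_swap_bij hTB u i.
(* An injection of the finite set [A] into itself is onto, so the sum can be reindexed by [Phi]. *)
have PhiA : [set Phi P | P in A] = A.
  apply/eqP; rewrite eqEcard card_in_imset // leqnn andbT.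
  by apply/subsetP => _ /imsetP[P /PhiP[PA _] ->].
rewrite -[in LHS]PhiA big_imset //=; apply: eq_bigr => P /PhiP[_ hPhi].
by congr F; apply/ffunP => l; rewrite !ffunE hPhi.
Qed.
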